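(* (1) Let $\mathbf{m}\in\{0,1\}^\infty$. Then $\mathbf{m}=\mathbf{m}_\le$ for some cylinder order $\le$ on $\{0,1\}^\infty$ with $0^\infty<1^\infty$ if and only if $\mathbf{m}=\sigma(10^\infty)$ for some $\sigma\in S^*$ or $\mathbf{m}=\boldsymbol{\sigma}(1^\infty)$ for some $\boldsymbol{\sigma}\in S^\infty$. Let now $\le$ be a cylinder order on $\{0,1\}^\infty$ with $0^\infty<1^\infty$. (2) If $\mathbf{m}_\le=\boldsymbol{\sigma}(1^\infty)$ with $\boldsymbol{\sigma}=(\sigma_n)_{n\ge1}\in S^\infty$, then $$\{\mathbf{a}\in\mathcal{M}_\le : \mathbf{a}<\mathbf{m}_\le\}=\{(\sigma_{[1,n]}(0))^\infty : n\ge0\}.$$ (3) If $\mathbf{m}_\le=\sigma_{[1,h]}(10^\infty)$ with $h\ge0$ and $\sigma_1,\dots,\sigma_h\in S$, then $$\{\mathbf{a}\in\mathcal{M}_\le : \mathbf{a}<\mathbf{m}_\le\}=\{(\sigma_{[1,n]}(0))^\infty : 0\le n\le h\}\cup\{\sigma_{[1,h]}((10^j)^\infty) : j\ge0,\ \sigma_{[1,h]}((10^j)^\infty)<\mathbf{m}_\le\},$$ and there is at most one $j\ge0$ such that $\sigma_{[1,h]}((10^j)^\infty)<\mathbf{m}_\le$.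
   Context: $\{0,1\}^\infty$ is the set of one-sided infinite words over $\{0,1\}$, with the ultrametric $d(a_1a_2\cdots,b_1b_2\cdots)=2^{-\min\{n\ge1 : a_n\ne b_n\}}$ for distinct words (and $d(\mathbf{a},\mathbf{a})=0$). A cylinder order on $\{0,1\}^\infty$ is a total order $\le$ such that $\mathbf{a}\le\mathbf{b}\le\mathbf{c}$ implies $d(\mathbf{a},\mathbf{b})\le d(\mathbf{a},\mathbf{c})$. For such an order, $s_\le(a_1a_2\cdots)=\sup_{n\ge1}a_na_{n+1}\cdots$ (supremum w.r.t. $\le$), $\mathcal{M}_\le=\{s_\le(\mathbf{a}):\mathbf{a}\in\{0,1\}^\infty\}$, and $\mathbf{m}_\le$ denotes the smallest (w.r.t. $\le$) accumulation point (w.r.t. $d$) of $\mathcal{M}_\le$. A substitution is a monoid morphism $\sigma:\{0,1\}^*\to\{0,1\}^*$ of finite words, extended naturally to $\{0,1\}^\infty$. Let $S=\{\tau_{j,k} : 0\le j<k\}$ ($j,k$ integers), where $\tau_{j,k}(0)=10^j$, $\tau_{j,k}(1)=10^k$. $S^*$ is the monoid generated by $S$ under composition (including the identity), and $S^\infty$ is the set of sequences $(\sigma_n)_{n\ge1}$ of elements of $S$. Write $\sigma_{[1,n]}=\sigma_1\circ\sigma_2\circ\cdots\circ\sigma_n$, with $\sigma_{[1,0]}$ the identity. For $\boldsymbol{\sigma}=(\sigma_n)_{n\ge1}\in S^\infty$, $\boldsymbol{\sigma}(1^\infty)=\lim_{n\to\infty}\sigma_{[1,n]}(1^\infty)$ denotes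 the limit word. *)

(* Defs.v *)
From mathcomp Require Import all_boot all_order all_algebra.
From mathcomp Require Import mathcomp_extra boolp classical_sets reals.

Set Implicit Arguments.
Unset Strict Implicit.
Unset Printing Implicit Defensive.

Import Order.TTheory GRing.Theory Num.Theory.
Local Open Scope classical_set_scope.
Local Open Scope ring_scope.

(* Letters are booleans (0 = false, 1 = true).  The word a_1 a_2 ... is the
   function [a] with [a n] = a_(n+1). *)
Definition word := seq bool.
Definition iword := nat -> bool.

(* w^oo, meant for a nonempty [w] *)
Definition per (w : word) : iword :=
  fun n => nth false w (n %% size w)%N.

Definition wcat (w : word) (a : iword) : iword :=
  fun n => if (n < size w)%N then nth false w n else a (n - size w)%N.

Definition zeros : iword := per [:: false].
Definition ones : iword := per [:: true].

Definition shift (n : nat) (a : iword) : iword := fun i => a (n + i)%N.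

(* The exponent is [(ex_minn h).+1] because indices start at 0 here. *)
Definition dist (R : realType) (a b : iword) : R :=
  match pselect (exists n, a n != b n) with
  | left h => 2 ^- (ex_minn h).+1
  | right _ => 0
  end.

Definition accumulation_point (R : realType) (A : set iword) (x : iword) : Prop :=
  forall e : R, 0 < e -> exists a, [/\ A a, a <> x & dist R x a < e].

Definition converges_to (R : realType) (u : nat -> iword) (x : iword) : Prop :=
  forall e : R, 0 < e ->
    exists N : nat, forall n, (N <= n)%N -> dist R (u n) x < e.

Definition total_order (T : Type) (le : rel T) : Prop :=
  [/\ reflexive le, antisymmetric le, transitive le & total le].

Definition cylinder_order (R : realType) (le : rel iword) : Prop :=
  total_order le /\
  forall a b c, le a b -> le b c -> dist R a b <= dist R a c.

Definition slt (le : rel iword) (a b : iword) : Prop := le a b /\ a <> b.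

Definition is_sup (le : rel iword) (A : set iword) (b : iword) : Prop :=
  (forall a, A a -> le a b) /\
  (forall c, (forall a, A a -> le a c) -> le b c).

Definition is_smallest (le : rel iword) (A : set iword) (b : iword) : Prop :=
  A b /\ forall a, A a -> le b a.

(* [xget zeros P] is the element of [P], or 0^oo when [P] is empty.  For a
   cylinder order the suprema below always exist. *)
Definition s_ (le : rel iword) (a : iword) : iword :=
  xget zeros (is_sup le (range (fun n => shift n a))).

Definition M_ (le : rel iword) : set iword := range (s_ le).

(* The default value 0^oo cannot be mistaken for a word sigma(1 0^oo) or
   sigma(1^oo) with substitutions as below, since these begin with 1. *)
Definition m_ (R : realType) (le : rel iword) : iword :=
  xget zeros (is_smallest le (accumulation_point R (M_ le))).

(* The type does not record that a substitution is a monoid morphism; the ones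
   used below are all built from [morph], [id] and composition. *)
Definition subst := word -> word.

Definition morph (f : bool -> word) : subst := fun w => flatten (map f w).

(* The (n+1)-st letter of sigma(a) is read off sigma(a_1 ... a_(n+1)), which
   has length at least n+1 when sigma is a nonerasing morphism; this is the
   case for all substitutions considered below. *)
Definition iext (sigma : subst) (a : iword) : iword :=
  fun n => nth false (sigma (mkseq a n.+1)) n.

Definition one_zeros (j : nat) : word := true :: nseq j false.

Definition tau (j k : nat) : subst :=
  morph (fun x => if x then one_zeros k else one_zeros j).

Definition S_ : set subst :=
  [set sigma | exists j k : nat, (j < k)%N /\ sigma = tau j k].

Inductive Sstar : subst -> Prop :=
| Sstar_id : Sstar id
| Sstar_gen sigma : S_ sigma -> Sstar sigma
| Sstar_comp sigma sigma' : Sstar sigma -> Sstar sigma' -> Sstar (sigma \o sigma').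

(* sigma_[1,n], where sigma_(n+1) is [s n] *)
Fixpoint scomp (s : nat -> subst) (n : nat) : subst :=
  if n is n'.+1 then scomp s n' \o s n' else id.

Definition Sinf (s : nat -> subst) : Prop := forall n, S_ (s n).

(* The limit exists and is unique when [Sinf s]. *)
Definition limit_word (R : realType) (s : nat -> subst) : iword :=
  xget zeros (converges_to R (fun n => iext (scomp s n) ones)).

(* Main.v *)
Require Import Defs.
From mathcomp Require Import all_boot all_order all_algebra.
From mathcomp Require Import mathcomp_extra boolp classical_sets reals.
From mathcomp Require Import zify.

Set Implicit Arguments.
Unset Strict Implicit.
Unset Printing Implicit Defensive.

Import Order.TTheory GRing.Theory Num.Theory.
Local Open Scope classical_set_scope.

(** The proof is a renormalization argument.

    A word other than 0^oo that dominates all its shifts begins with 1, and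
    all its blocks 1 0^i are at most its first block.  So everything is decided
    by the order of the cylinders of 1 0^i 1 relative to each other and to
    10^oo, which is always an accumulation point (of the words (1 0^i)^oo).
    Each such cylinder lies entirely below or entirely above 10^oo.

    If at most one of them is below, then the dominating words smaller than
    10^oo are 0^oo and at most one word (1 0^j)^oo, so that m = 10^oo
    ([one_low_m], [one_low_below]).

    Otherwise let 1 0^j 1 and 1 0^k 1 with j < k be the two lowest ones.  A
    dominating word beginning with one of them has no other blocks than 1 0^j
    and 1 0^k, hence is the image under tau_{j,k} of a word that dominates its
    shifts for the order pulled back by tau_{j,k}, again a cylinder order with
    0^oo < 1^oo.  Therefore m is the image of the m of the pulled back order,
    and the dominating words below m are 0^oo and the images of those below the
    new m ([two_low_m], [two_low_below]).

    Iterating, either the first case occurs after finitely many steps, and m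
    is the image of 10^oo, or it never occurs, and m is a limit word
    ([m_characterization]).  A word beginning with 10 can be recovered,
    together with j and k, from its image under tau_{j,k} ([tau_decomp]);
    therefore any representation of m follows these steps, and the words below
    m are found by induction ([below_limit], [below_ten_image]).

    Conversely, the words smaller than m have to be those that leave m where
    one of the words (sigma_[1,n](0))^oo leaves it.  An order in which the
    smaller of the two letters depends only on the position satisfies this
    ([adapted_exists]), the property is inherited by the pulled back orders
    ([adapted_tau]), and it forces the steps above to be the given ones. *)

(** * Agreement and first differences *)

Definition agree (n : nat) (a b : iword) : Prop :=
  forall i, (i < n)%N -> a i = b i.

Definition fdiff (n : nat) (a b : iword) : Prop := agree n a b /\ a n <> b n.

Lemma agree_sym n a b : agree n a b -> agree n b a.
Proof. by move=> h i /h. Qed.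

Lemma agree_trans n a b c : agree n a b -> agree n b c -> agree n a c.
Proof. by move=> h h' i hi; rewrite h ?h'. Qed.

Lemma agree_le n p a b : (p <= n)%N -> agree n a b -> agree p a b.
Proof. by move=> hp h i hi; apply: h; exact: leq_trans hp. Qed.

Lemma agreeS n a b : agree n a b -> a n = b n -> agree n.+1 a b.
Proof. by move=> h e i; rewrite ltnS leq_eqVlt => /orP[/eqP->|/h]. Qed.

Lemma agree_eq a b : (forall n, agree n a b) -> a = b.
Proof. by move=> h; apply/funext => n; apply: (h n.+1). Qed.

Lemma fdiff_sym n a b : fdiff n a b -> fdiff n b a.
Proof. by case=> h hn; split; [exact: agree_sym|move=> e; apply: hn]. Qed.

Lemma fdiff_neq n a b : fdiff n a b -> a <> b.
Proof. by case=> _ h e; apply: h; rewrite e. Qed.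

Lemma fdiff_agreeF n p a b : fdiff n a b -> agree p a b -> (p <= n)%N.
Proof. by move=> [_ h] h'; rewrite leqNgt; apply/negP => /h'. Qed.

Lemma fdiff_uniq n p a b : fdiff n a b -> fdiff p a b -> n = p.
Proof.
move=> h h'; apply/eqP; rewrite eqn_leq.
by rewrite (fdiff_agreeF h' (proj1 h)) (fdiff_agreeF h (proj1 h')).
Qed.

Lemma fdiff_agree n a b a' b' :
  fdiff n a b -> agree n.+1 a a' -> agree n.+1 b b' -> fdiff n a' b'.
Proof.
move=> [h hn] ha hb; split; last by rewrite -ha // -hb.
apply: agree_trans (agree_sym (agree_le (leqnSn n) ha)) _.
exact: agree_trans h (agree_le (leqnSn n) hb).
Qed.

Lemma neq_letters (x y z : bool) : x <> y -> z <> y -> x = z.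
Proof. by case: x; case: y; case: z. Qed.

Lemma agree_or_fdiff n a b :
  agree n a b \/ exists2 i, (i < n)%N & fdiff i a b.
Proof.
elim: n => [|n [IH|[i hi h]]]; first by left.
  have [e|ne] := eqVneq (a n) (b n); first by left; exact: agreeS.
  by right; exists n => //; split=> //; apply/eqP.
by right; exists i => //; exact: ltnW.
Qed.

Lemma neq_fdiff a b : a <> b -> exists n, fdiff n a b.
Proof.
move=> ne; apply: contrapT => h; apply: ne; apply: agree_eq => n.
by case: (agree_or_fdiff n a b) => // -[i _ hi]; case: h; exists i.
Qed.

Lemma fdiff_shift n a b : fdiff n a b -> shift n a 0 <> shift n b 0.
Proof. by rewrite /shift addn0; case. Qed.

(** * Concatenation *)

Lemma shiftD n p a : shift n (shift p a) = shift (p + n) a.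
Proof. by apply/funext => i; rewrite /shift addnA. Qed.

Lemma shift0 a : shift 0 a = a.
Proof. by []. Qed.

Lemma wcat0 a : wcat [::] a = a.
Proof. by apply/funext => i; rewrite /wcat /= subn0. Qed.

Lemma wcat_lt w a i : (i < size w)%N -> wcat w a i = nth false w i.
Proof. by rewrite /wcat => ->. Qed.

Lemma wcat_ge w a i : wcat w a (size w + i) = a i.
Proof. by rewrite /wcat ltnNge leq_addr addKn. Qed.

Lemma wcat_cat u v a : wcat (u ++ v) a = wcat u (wcat v a).
Proof.
apply/funext => i; rewrite /wcat size_cat nth_cat.
case: (ltnP i (size u)) => hi; first by rewrite ltn_addr.
by rewrite -{1}(subnKC hi) ltn_add2l subnDA.
Qed.

Lemma shift_wcat w a : shift (size w) (wcat w a) = a.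
Proof. by apply/funext => i; rewrite /shift wcat_ge. Qed.

Lemma shift_wcat_ge w a n : (size w <= n)%N ->
  shift n (wcat w a) = shift (n - size w) a.
Proof. by move=> h; rewrite -{1}(subnKC h) -shiftD shift_wcat. Qed.

Lemma wcat_mkseq a n : wcat (mkseq a n) (shift n a) = a.
Proof.
apply/funext => i; rewrite /wcat /shift size_mkseq.
by case: (ltnP i n) => hi; [rewrite nth_mkseq|rewrite subnKC].
Qed.

Lemma agree_mkseq n a b : agree n a b -> mkseq a n = mkseq b n.
Proof.
by move=> h; apply/eq_in_map => i; rewrite mem_iota add0n => /h.
Qed.

Lemma agree_wcat w n a b :
  agree n a b -> agree (size w + n) (wcat w a) (wcat w b).
Proof.
move=> h i hi; rewrite /wcat; case: ltnP => // hw; apply: h.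
by rewrite ltn_subLR.
Qed.

Lemma fdiff_wcat w n a b :
  fdiff n a b -> fdiff (size w + n) (wcat w a) (wcat w b).
Proof. by move=> [h hn]; split; [exact: agree_wcat|rewrite !wcat_ge]. Qed.

(** Coinduction: it suffices that related words split off equal nonempty
    prefixes and stay related, because each round determines more letters. *)
Lemma iword_bisim (r : iword -> iword -> Prop) :
  (forall x y, r x y -> exists w x' y',
     [/\ w <> [::], x = wcat w x', y = wcat w y' & r x' y']) ->
  forall x y, r x y -> x = y.
Proof.
move=> hr x y hxy; apply: agree_eq => n.
elim: n x y hxy => [//|n IH] x y /hr[w [x' [y' [w0 -> -> /IH h]]]].
apply: (agree_le _ (agree_wcat (w := w) h)); case: w w0 => // c w _ /=; lia.
Qed.

Lemma perE w : w <> [::] -> per w = wcat w (per w).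
Proof.
move=> w0; have sw : (0 < size w)%N by case: w w0.
apply/funext => i; rewrite /wcat /per; case: ltnP => hi.
  by rewrite modn_small.
by rewrite -{1}(subnK hi) modnDr.
Qed.

Lemma per_uniq w a : w <> [::] -> a = wcat w a -> a = per w.
Proof.
move=> w0 ea.
apply: (@iword_bisim (fun x y => x = a /\ y = per w)) => // x y [-> ->].
by exists w, a, (per w); split=> //; exact: perE.
Qed.

Lemma zerosE i : zeros i = false.
Proof. by rewrite /zeros /per /= modn1. Qed.

Lemma onesE i : ones i = true.
Proof. by rewrite /ones /per /= modn1. Qed.

Lemma shift_zeros n : shift n zeros = zeros.
Proof. by apply/funext => i; rewrite /shift !zerosE. Qed.

(** * Nonerasing morphisms on infinite words *)

Definition nonerasing (f : bool -> word) : Prop := forall x, f x <> [::].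

Lemma morph_cat f u v : morph f (u ++ v) = morph f u ++ morph f v.
Proof. by rewrite /morph map_cat flatten_cat. Qed.

Lemma morph_comp f g : morph f \o morph g = morph (morph f \o g).
Proof.
apply/funext => w /=; elim: w => //= x w IH.
by rewrite -[morph g (x :: w)]/(g x ++ morph g w) morph_cat IH.
Qed.

Lemma morph_id : (id : subst) = morph (fun x => [:: x]).
Proof. by apply/funext; elim=> //= x w {1}->. Qed.

Lemma nonerasing_comp f g :
  nonerasing f -> nonerasing g -> nonerasing (morph f \o g).
Proof.
move=> hf hg x /=; case: (g x) (hg x) => // c w _; rewrite /morph /=.
by case: (f c) (hf c).
Qed.

Lemma size_morph f w : nonerasing f -> (size w <= size (morph f w))%N.
Proof.
move=> hf; elim: w => //= x w IH.
rewrite -[morph f (x :: w)]/(f x ++ morph f w) size_cat.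
case: (f x) (hf x) => //= c u _; lia.
Qed.

Lemma mkseqD a n p : mkseq a (n + p) = mkseq a n ++ mkseq (shift n a) p.
Proof.
rewrite /mkseq iotaD map_cat add0n -{2}(addn0 n) iotaDl.
by rewrite -map_comp.
Qed.

Lemma mkseqS_shift a n : mkseq a n.+1 = a 0 :: mkseq (shift 1 a) n.
Proof. by rewrite -add1n mkseqD. Qed.

Lemma iext_step f a : nonerasing f ->
  iext (morph f) a = wcat (f (a 0)) (iext (morph f) (shift 1 a)).
Proof.
move=> hf; apply/funext => n; rewrite /wcat /iext mkseqS_shift.
rewrite -cat1s morph_cat nth_cat {1 2 4}/morph /= cats0.
case: ltnP => // hn; set p := (n - _)%N.
have hp : (p.+1 <= n)%N.
  by rewrite /p; move: hn; case: (f _) (hf (a 0)) => //= c w _; lia.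
rewrite -(subnKC hp) mkseqD morph_cat nth_cat ifT //.
by apply: leq_trans (size_morph _ hf); rewrite size_mkseq.
Qed.

Lemma iext_wcat f w a : nonerasing f ->
  iext (morph f) (wcat w a) = wcat (morph f w) (iext (morph f) a).
Proof.
move=> hf; elim: w => [|x w IH]; first by rewrite !wcat0.
rewrite iext_step // -cat1s wcat_cat morph_cat wcat_cat -IH.
by rewrite (shift_wcat [:: x]) /morph /= cats0.
Qed.

Lemma iext_comp f g a : nonerasing f -> nonerasing g ->
  iext (morph f \o morph g) a = iext (morph f) (iext (morph g) a).
Proof.
move=> hf hg; rewrite morph_comp; have hfg := nonerasing_comp hf hg.
pose r x y := exists a, x = iext (morph (morph f \o g)) a /\
                        y = iext (morph f) (iext (morph g) a).
apply: (@iword_bisim r); last by exists a.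
move=> x y [{}a [-> ->]]; exists (morph f (g (a 0))).
exists (iext (morph (morph f \o g)) (shift 1 a)).
exists (iext (morph f) (iext (morph g) (shift 1 a))).
split; [exact: hfg|exact: iext_step| |by exists (shift 1 a)].
by rewrite (iext_step a hg) iext_wcat.
Qed.

Lemma iext_id a : iext id a = a.
Proof. by apply/funext => n; rewrite /iext nth_mkseq. Qed.

Lemma iext_per f w : nonerasing f -> w <> [::] ->
  iext (morph f) (per w) = per (morph f w).
Proof.
move=> hf w0; apply: per_uniq; last by rewrite -iext_wcat // -perE.
move=> e; have := size_morph w hf; rewrite e.
by case: w w0 {e}.
Qed.

(** * The metric *)

Lemma exp2V_le (R : realType) (n p : nat) :
  ((2 : R) ^- n.+1 <= 2 ^- p.+1)%R = (p <= n)%N.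
Proof.
rewrite lef_pV2 ?posrE ?exprn_gt0 // ler_eXn2l //.
by rewrite ltr1n.
Qed.

Lemma exp2V_small (R : realType) (e : R) :
  (0 < e)%R -> exists n, ((2 : R) ^- n.+1 < e)%R.
Proof.
move=> e0; exists (Num.truncn e^-1)%R.
rewrite -[ltRHS]invrK ltf_pV2 ?posrE ?exprn_gt0 ?invr_gt0 //.
apply: lt_trans (truncnS_gt _) _.
by rewrite -natrX ltr_nat ltn_expl.
Qed.

Lemma dist_le_agree (R : realType) n a b :
  (dist R a b <= 2 ^- n.+1)%R <-> agree n a b.
Proof.
rewrite /dist; case: pselect => [h|h].
  case: ex_minnP => p hp pmin; rewrite exp2V_le; split=> [np i ni|ag].
    apply/eqP/negPn/negP => /pmin; rewrite leqNgt.
    by rewrite (leq_trans ni np).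
  by rewrite leqNgt; apply/negP => /ag /eqP; exact/negP.
split=> [_ i _|_]; last by rewrite invr_ge0 exprn_ge0.
by apply/eqP/negPn/negP => ne; apply: h; exists i.
Qed.

Lemma dist_fdiff (R : realType) n a b :
  fdiff n a b -> dist R a b = (2 ^- n.+1)%R.
Proof.
move=> h; rewrite /dist; case: pselect => [h'|[]]; last first.
  by exists n; apply/eqP; case: h.
case: ex_minnP => p hp pmin; suff -> : p = n by [].
apply: (@fdiff_uniq _ _ a b) h; split; last exact/eqP.
move=> i ip; apply/eqP/negPn/negP => /pmin; by rewrite leqNgt ip.
Qed.

Lemma accumulation_pointP (R : realType) A x :
  accumulation_point R A x <->
  forall n, exists a, [/\ A a, a <> x & agree n x a].
Proof.
split=> [h n|h e /exp2V_small[n hn]].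
  have [|a [Aa ax /ltW /dist_le_agree d]] := h (2 ^- n.+1)%R.
    by rewrite invr_gt0 exprn_gt0.
  by exists a.
have [a [Aa ax /dist_le_agree d]] := h n; exists a; split=> //.
exact: le_lt_trans (d R) hn.
Qed.

Lemma converges_toP (R : realType) u x :
  converges_to R u x <->
  forall n, exists N, forall p, (N <= p)%N -> agree n (u p) x.
Proof.
split=> [h n|h e /exp2V_small[n hn]].
  have [|N hN] := h (2 ^- n.+1)%R; first by rewrite invr_gt0 exprn_gt0.
  by exists N => p /hN/ltW/dist_le_agree.
have [N hN] := h n; exists N => p /hN /dist_le_agree d.
exact: le_lt_trans (d R) hn.
Qed.

(** * Cylinder orders *)

(** The metric-free form of a cylinder order, see [cylinder_orderP]. *)
Definition cyl (le : rel iword) : Prop :=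
  total_order le /\
  forall a b c n, le a b -> le b c -> agree n a c -> agree n a b.

Lemma cylinder_orderP (R : realType) le : cylinder_order R le <-> cyl le.
Proof.
split=> -[tot h]; split=> // a b c; first move=> n ab bc /dist_le_agree ac.
  by apply/(dist_le_agree R); exact: le_trans (h _ _ _ ab bc) (ac R).
move=> ab bc; have [e|/neq_fdiff[n hn]] := pselect (a = c).
  case: tot => _ anti _ _; suff -> : b = c by [].
  by apply: anti; rewrite bc -e ab.
rewrite (dist_fdiff R hn); apply/dist_le_agree.
by apply: h ab bc _; case: hn.
Qed.

Lemma cyl_refl le a : cyl le -> le a a.
Proof. by case=> -[]. Qed.

Lemma cyl_anti le a b : cyl le -> le a b -> le b a -> a = b.
Proof. by case=> -[_ anti _ _] _ ab ba; apply: anti; rewrite ab. Qed.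

Lemma cyl_trans le a b c : cyl le -> le a b -> le b c -> le a c.
Proof. by case=> -[_ _ tr _] _; exact: tr. Qed.

Lemma le_sltF le a b : cyl le -> le a b -> slt le b a -> False.
Proof. by move=> C ab [ba]; apply; exact: cyl_anti C ba ab. Qed.

Lemma nle_slt le a b : cyl le -> ~ le a b -> slt le b a.
Proof.
move=> C nab; split; last by move=> e; apply: nab; rewrite e; exact: cyl_refl.
by case: C nab => -[_ _ _ tot] _; case/orP: (tot a b).
Qed.

Lemma neq_slt le a b : cyl le -> a <> b -> slt le a b \/ slt le b a.
Proof.
by move=> C ne; have [ab|/negP/(nle_slt C)] := boolP (le a b); [left|right].
Qed.

Lemma le_slt_trans le a b c : cyl le -> le a b -> slt le b c -> slt le a c.
Proof.
move=> C ab [bc ne]; split; first exact: cyl_trans C ab bc.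
by move=> e; apply: ne; apply: cyl_anti C bc _; rewrite -e.
Qed.

Lemma slt_trans le a b c : cyl le -> slt le a b -> slt le b c -> slt le a c.
Proof. by move=> C [ab _]; exact: le_slt_trans. Qed.

(** Cylinders are convex: if the comparison changed, one of the words would lie
    between two words of a cylinder that does not contain it. *)
Lemma slt_agree le n a b a' b' : cyl le -> slt le a b -> fdiff n a b ->
  agree n.+1 a a' -> agree n.+1 b b' -> slt le a' b'.
Proof.
move=> C ab [_ h] aa' bb'.
have conv x y z : le x y -> le y z -> agree n.+1 x z -> x n = y n.
  by move=> xy yz xz; apply: (C.2 x y z n.+1).
have a'b : slt le a' b.
  apply: nle_slt => // ba'; apply: h.
  exact: conv ab.1 ba' aa'.
apply: nle_slt => // b'a'; apply: h.
by rewrite aa' // bb' //; apply/esym/(conv _ _ _ b'a' a'b.1)/agree_sym.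
Qed.

Lemma cyl_dual le : cyl le -> cyl (fun a b => le b a).
Proof.
move=> [[rf anti tr tot] conv]; split; first split=> //.
- by move=> a b /= /andP[ab ba]; apply: anti; rewrite ab ba.
- by move=> b a c ab bc; exact: tr bc ab.
move=> a b c n ba cb ac; apply: (agree_trans ac).
by apply: (conv c b a n cb ba); exact: agree_sym.
Qed.

(** Compactness: letter by letter one picks the larger of the two cylinders
    among those that still meet [A]. *)
Lemma cyl_sup le (A : set iword) : cyl le -> (exists a, A a) ->
  exists b, is_sup le A b /\ forall n, exists2 a, A a & agree n b a.
Proof.
move=> C [a0 A0].
have step n a : exists a', A a -> [/\ A a', agree n a a' & forall c, A c ->
    agree n c a -> agree n.+1 c a' \/ slt le c a'].
  have [Aa|] := pselect (A a); last by exists a.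
  have [[a' [Aa' aa' h]]|h] := pselect (exists a',
      [/\ A a', agree n a a' & a' n <> a n /\ slt le a a']).
    exists a' => _; split=> // c Ac ca.
    have ca' : agree n c a' by exact: agree_trans ca aa'.
    have [e|ne] := eqVneq (c n) (a' n); first by left; exact: agreeS.
    right; apply: (slt_agree C h.2 (n := n)) => //.
      by split=> //; move/esym; exact: h.1.
    apply: agreeS; first exact: agree_sym.
    by apply: neq_letters (_ : _ <> a' n) _; [move/esym; exact: h.1|exact/eqP].
  exists a => _; split=> // c Ac ca.
  have [e|ne] := eqVneq (c n) (a n); first by left; exact: agreeS.
  right; case: (@neq_slt le c a C) => //.
    by move=> e; rewrite e eqxx in ne.
  move=> ac; case: h; exists c; split=> //; first exact: agree_sym.
  by split=> //; exact/eqP.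
have [g hg] := choice (fun na => step na.1 na.2).
pose u := fix u n := if n is n'.+1 then g (n', u n') else a0.
have Au n : A (u n) by elim: n => //= n /(hg (n, _))[].
have uS n := hg (n, u n) (Au n).
pose b : iword := fun n => u n.+1 n.
have bu n : agree n b (u n).
  elim: n => // n IH; apply: agreeS => //.
  by apply: agree_trans IH _; case: (uS n).
exists b; split; last by move=> n; exists (u n).
split=> [c Ac|c hc].
  have [->|/neq_fdiff[n [cb ne]]] := pselect (c = b); first exact: cyl_refl.
  have [_ _ /(_ c Ac)] := uS n; case; first exact: agree_trans cb (bu n).
    by move/(_ n (ltnSn n)) => e; case: ne; rewrite e.
  move=> cu; suff [] : slt le c b by [].
  apply: (slt_agree C cu (n := n)) => //; last exact/agree_sym/(bu n.+1).
  split; last exact: ne.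
  by apply: agree_trans cb _; exact: agree_le (bu n.+1).
have [//|/negP/(nle_slt C) cb] := boolP (le b c).
have [n d] := neq_fdiff cb.2; case: (@le_sltF le (u n.+1) c) => //.
  exact: hc.
by apply: (slt_agree C cb d) => //; exact: bu.
Qed.

Lemma is_sup_uniq le A b c : cyl le -> is_sup le A b -> is_sup le A c -> b = c.
Proof. by move=> C [h1 h2] [h3 h4]; apply: cyl_anti C _ _; auto. Qed.

(** * The words that dominate their shifts *)

Definition shift_max (le : rel iword) (a : iword) : Prop :=
  forall n, le (shift n a) a.

(** Each prefix of the supremum of the shifts of [c] is a factor of [c], so the
    supremum cannot be exceeded by a shift of its own. *)
Lemma M_E le a : cyl le -> M_ le a <-> shift_max le a.
Proof.
move=> C.
have sup c b : is_sup le (range (fun n => shift n c)) b -> s_ le c = b.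
  move=> h; apply: xget_unique => // d hd; exact: is_sup_uniq hd h.
split=> [[c _ <-]|h]; last first.
  exists a => //; apply: sup; split=> [_ [n _ <-]|d hd]; first exact: h.
  by apply: hd; exists 0%N; rewrite ?shift0.
have [|b [/[dup] /sup -> [ub _] hb]] :=
    @cyl_sup le (range (fun n => shift n c)) C; first by exists c, 0%N.
move=> n; have [//|/negP/(nle_slt C) cb] := boolP (le (shift n b) b).
have [p d] := neq_fdiff cb.2; have [_ [q _ <-] bc] := hb (n + p.+1)%N.
case: (@le_sltF le (shift n (shift q c)) b) => //.
  by apply: ub; exists (q + n)%N; rewrite ?shiftD.
apply: (slt_agree C cb d) => // i hi; rewrite /shift.
by rewrite -[RHS]/(shift q c _) bc // ltn_add2l.
Qed.


Lemma shift_max_closed le b : cyl le ->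
  (forall n, exists2 a, shift_max le a & agree n b a) -> shift_max le b.
Proof.
move=> C h n; have [//|/negP/(nle_slt C) cb] := boolP (le (shift n b) b).
have [p d] := neq_fdiff cb.2; have [a ha ab] := h (n + p.+1)%N.
case: (@le_sltF le (shift n a) a) => //.
apply: (slt_agree C cb d) => i hi; rewrite /shift -ab //; lia.
Qed.

Definition acc (le : rel iword) (x : iword) : Prop :=
  forall n, exists a, [/\ shift_max le a, a <> x & agree n x a].

Lemma acc_shift_max le x : cyl le -> acc le x -> shift_max le x.
Proof.
move=> C h; apply: shift_max_closed => // n.
by have [a []] := h n; exists a.
Qed.

Lemma is_smallest_acc (R : realType) le x : cyl le ->
  is_smallest le (accumulation_point R (M_ le)) x <->
  is_smallest le (acc le) x.
Proof.
move=> C; suff -> : accumulation_point R (M_ le) = acc le by [].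
apply/seteqP; split=> y; rewrite accumulation_pointP => h n.
  by have [a [/(M_E _ C) Ma ne ag]] := h n; exists a.
by have [a [/(M_E _ C) Ma ne ag]] := h n; exists a.
Qed.

Lemma m_uniq (R : realType) le x : cyl le ->
  is_smallest le (acc le) x -> m_ R le = x.
Proof.
move=> C h; apply: xget_unique; first exact/is_smallest_acc.
move=> y /(is_smallest_acc _ _ C)[hy hy'].
by apply: cyl_anti C _ _; [apply: hy'; case: h|apply: h.2].
Qed.

(** The accumulation points form a closed set, so their infimum, which exists by
    compactness, is one of them. *)
Lemma m_smallest (R : realType) le : cyl le -> (exists x, acc le x) ->
  is_smallest le (acc le) (m_ R le).
Proof.
move=> C [x hx].
have [b [[lb glb] hb]] : exists b, is_sup (fun a b => le b a) (acc le) b /\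
    forall n, exists2 a, acc le a & agree n b a.
  by apply: cyl_sup; [exact: cyl_dual|exists x].
suff sm : is_smallest le (acc le) b by rewrite (m_uniq R C sm).
split=> // n.
have [y hy byn] := hb n.
have [->|/neq_fdiff[p [byp nep]]] := pselect (b = y); first exact: hy.
have [a [Ma ne ya]] := hy (maxn n p.+1).
exists a; split=> //.
  move=> ab; apply: nep; rewrite -ab; apply/esym/ya; lia.
apply: agree_trans byn _; apply: agree_le ya; lia.
Qed.

(** * The substitutions tau *)

Definition ten : iword := wcat [:: true] zeros.

(** This says that [a] begins with 1 0^i 1.  As a first difference with 10^oo,
    it directly yields comparisons with 10^oo. *)
Definition starts (i : nat) (a : iword) : Prop := fdiff i.+1 a ten.

Lemma ten0 : ten 0 = true. Proof. by []. Qed.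

Lemma tenS i : ten i.+1 = false.
Proof. by rewrite /ten /wcat /= zerosE. Qed.

Lemma ten_wcat i : ten = wcat (one_zeros i) zeros.
Proof.
apply/funext => -[|n]; rewrite ?tenS // /wcat /= zerosE nth_nseq.
by rewrite if_same; case: ifP.
Qed.

Lemma starts0 i a : starts i a -> a 0 = true.
Proof. by case=> /(_ 0%N isT). Qed.

Lemma startsE i a : starts i a -> a = wcat (one_zeros i) (shift i.+1 a).
Proof.
case=> h _; rewrite -{1}(wcat_mkseq a i.+1) (agree_mkseq h) (ten_wcat i).
congr wcat; apply: (@eq_from_nth _ false) => [|n].
  by rewrite size_mkseq /= size_nseq.
rewrite size_mkseq => hn; rewrite nth_mkseq // wcat_lt //=.
by rewrite size_nseq.
Qed.

Lemma starts_next i a : starts i a -> a i.+1 = true.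
Proof. by case=> _; rewrite tenS; case: (a _). Qed.

Lemma size_one_zeros i : size (one_zeros i) = i.+1.
Proof. by rewrite /= size_nseq. Qed.

Lemma starts_wcat i a : a 0 = true -> starts i (wcat (one_zeros i) a).
Proof.
move=> a0; rewrite /starts (ten_wcat i) -[in fdiff _](size_one_zeros i).
rewrite -[X in fdiff X]addn0; apply: fdiff_wcat; split=> //.
by rewrite a0 zerosE.
Qed.

Lemma starts_uniq i p a : starts i a -> starts p a -> i = p.
Proof. by move=> h h'; case: (fdiff_uniq h h'). Qed.

Lemma starts_fdiff i p a b : (i < p)%N -> starts i a -> starts p b ->
  fdiff i.+1 a b.
Proof.
move=> ip ha hb; apply: (fdiff_agree ha) => //.
by apply/agree_sym/(agree_le _ hb.1).
Qed.

Lemma starts_agree i a b : starts i a -> agree i.+2 a b -> starts i b.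
Proof. by move=> h ab; apply: (fdiff_agree h). Qed.

Lemma starts_ex a : a 0 = true -> a <> ten -> exists i, starts i a.
Proof.
by move=> a0 /neq_fdiff[[|n] h]; [case: h; rewrite a0|exists n].
Qed.

Lemma tau_nonerasing j k :
  nonerasing (fun x => if x then one_zeros k else one_zeros j).
Proof. by case. Qed.

Lemma tau_wcat j k w a :
  iext (tau j k) (wcat w a) = wcat (tau j k w) (iext (tau j k) a).
Proof. exact/iext_wcat/tau_nonerasing. Qed.

Lemma tau_step j k a : iext (tau j k) a =
  wcat (one_zeros (if a 0 then k else j)) (iext (tau j k) (shift 1 a)).
Proof.
rewrite {1}/tau iext_step; last exact: tau_nonerasing.
by case: (a 0).
Qed.

Lemma tau_hd j k a : iext (tau j k) a 0 = true.
Proof. by rewrite tau_step. Qed.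

Lemma tau_starts j k a : starts (if a 0 then k else j) (iext (tau j k) a).
Proof. by rewrite tau_step; apply: starts_wcat; exact: tau_hd. Qed.

Lemma tau_neq_ten j k a : iext (tau j k) a <> ten.
Proof. by move=> e; have := tau_starts j k a; rewrite e => -[_]. Qed.

(** Where two words first differ, their images continue with 1 0^j 1 and
    1 0^k, so the images differ j+1 letters later. *)
Lemma tau_fdiff j k n a b : (j < k)%N -> fdiff n a b ->
  fdiff (size (tau j k (mkseq a n)) + j.+1)
        (iext (tau j k) a) (iext (tau j k) b).
Proof.
move=> jk h; have := fdiff_shift h.
rewrite -{3}(wcat_mkseq a n) -{2}(wcat_mkseq b n) -(agree_mkseq h.1).
rewrite !tau_wcat => ne; apply: fdiff_wcat.
have := tau_starts j k (shift n a); have := tau_starts j k (shift n b).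
case: (shift n a 0) (shift n b 0) ne => -[] //= _ hb ha.
  by apply/fdiff_sym/(starts_fdiff jk).
exact: starts_fdiff jk _ _.
Qed.

Lemma tau_agree j k n a b : (j < k)%N -> agree n.+1 a b ->
  agree (size (tau j k (mkseq a n)) + j.+2)
        (iext (tau j k) a) (iext (tau j k) b).
Proof.
move=> jk h; have hn := agree_le (leqnSn n) h.
have := h n (ltnSn n); rewrite -{3}(wcat_mkseq a n) -{2}(wcat_mkseq b n).
rewrite -(agree_mkseq hn) !tau_wcat => e; apply: agree_wcat.
have := startsE (tau_starts j k (shift n a)).
have := startsE (tau_starts j k (shift n b)).
have := starts_next (tau_starts j k (shift n a)).
have := starts_next (tau_starts j k (shift n b)).
have -> : shift n a 0 = b n by rewrite /shift addn0.
have -> : shift n b 0 = b n by rewrite /shift addn0.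
set l := if b n then k else j; have jl : (j <= l)%N.
  by rewrite /l; case: (b n) => //; exact: ltnW.
move=> hb ha -> ->; apply: (@agree_le l.+2); first by rewrite !ltnS.
rewrite -[l.+2]addn1 -[X in (X + _)%N](size_one_zeros l).
apply: agree_wcat => -[|//] _.
by rewrite /shift addn0 ha hb.
Qed.

Lemma size_tau j k w : (size w <= size (tau j k w))%N.
Proof. exact/size_morph/tau_nonerasing. Qed.

Lemma size_tau_le j k w : (j < k)%N ->
  (size (tau j k w) <= k.+1 * size w)%N.
Proof.
move=> jk; elim: w => //= x w IH.
rewrite -[tau j k (x :: w)]/((if x then one_zeros k else one_zeros j)
   ++ tau j k w) size_cat mulnS.
by apply: leq_add IH; case: x; rewrite size_one_zeros // ltnS ltnW.
Qed.

Lemma tau_agree_le j k n a b : (j < k)%N -> agree n a b ->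
  agree n.+1 (iext (tau j k) a) (iext (tau j k) b).
Proof.
case: n => [|n] jk h; first by case=> // _; rewrite !tau_hd.
apply: agree_le (tau_agree jk h).
by have := size_tau j k (mkseq a n); rewrite size_mkseq; lia.
Qed.

Lemma tau_agree_inv j k n a b : (j < k)%N ->
  agree (k.+1 * n) (iext (tau j k) a) (iext (tau j k) b) -> agree n a b.
Proof.
move=> jk h; case: (agree_or_fdiff n a b) => // -[i hi /(tau_fdiff jk) d].
have := fdiff_agreeF d h.
have := size_tau_le (mkseq a i) jk; rewrite size_mkseq => h1 h2.
have : (k.+1 * i.+1 <= k.+1 * n)%N by rewrite leq_mul2l hi orbT.
rewrite mulnS; lia.
Qed.

Lemma tau_inj j k a b : (j < k)%N ->
  iext (tau j k) a = iext (tau j k) b -> a = b.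
Proof.
move=> jk e; have [//|/neq_fdiff[n /(tau_fdiff jk)/fdiff_neq]] :=
  pselect (a = b).
by rewrite e.
Qed.

(** The first two blocks of the image of a word beginning with 10 are 1 0^k
    and 1 0^j, hence such an image reveals both parameters. *)
Lemma tau_decomp j k j' k' a b : (j < k)%N -> (j' < k')%N ->
  a 0 = true -> a 1 = false -> b 0 = true -> b 1 = false ->
  iext (tau j k) a = iext (tau j' k') b -> [/\ j = j', k = k' & a = b].
Proof.
move=> jk jk' a0 a1 b0 b1 e.
have ek : k = k'.
  have := tau_starts j k a; have := tau_starts j' k' b.
  by rewrite a0 b0 e => h1 h2; exact: starts_uniq h2 h1.
have ej : j = j'.
  have e1 : iext (tau j k) (shift 1 a) = iext (tau j' k') (shift 1 b).
    have := congr1 (shift k.+1) e.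
    rewrite tau_step [X in _ = shift _ X]tau_step.
    by rewrite a0 b0 -ek -(size_one_zeros k) !shift_wcat.
  have := tau_starts j k (shift 1 a); have := tau_starts j' k' (shift 1 b).
  by rewrite /shift addn0 a1 b1 -/(shift 1 a) -/(shift 1 b) e1 => h1 h2;
     exact: starts_uniq h2 h1.
by split=> //; apply: (tau_inj jk); rewrite e ek ej.
Qed.

Lemma tau_shift j k a i : exists n,
  shift n (iext (tau j k) a) = iext (tau j k) (shift i a).
Proof.
exists (size (tau j k (mkseq a i))).
by rewrite -{2}(wcat_mkseq a i) tau_wcat shift_wcat.
Qed.

Lemma shift_tau j k a n : iext (tau j k) a n = true ->
  exists i, shift n (iext (tau j k) a) = iext (tau j k) (shift i a).
Proof.
elim/ltn_ind: n a => n IH a; rewrite tau_step.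
set l := if a 0 then k else j; set x := iext _ _.
case: (ltnP n l.+1) => [hn|hn].
  rewrite wcat_lt ?size_one_zeros //.
  case: n {IH} hn => [_ _|n hn]; first by exists 0%N; rewrite !shift0 tau_step.
  by rewrite /= nth_nseq -ltnS hn.
have hn' : (size (one_zeros l) <= n)%N by rewrite size_one_zeros.
rewrite -{1}(subnKC hn') wcat_ge shift_wcat_ge // => h.
have [|i ->] := IH (n - size (one_zeros l))%N _ (shift 1 a) h.
  by rewrite size_one_zeros; lia.
by exists (1 + i)%N; rewrite shiftD.
Qed.

(** The preimage is read off block by block: [pos i] is where the i-th block
    begins, and the i-th letter is 1 exactly if that block is 1 0^k. *)
Lemma tau_image j k a : a 0 = true ->
  (forall n, a n = true -> starts j (shift n a) \/ starts k (shift n a)) ->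
  exists b, a = iext (tau j k) b.
Proof.
move=> a0 ha.
pose isk n := `[< starts k (shift n a) >].
pose pos := fix pos i :=
  if i is i'.+1 then (pos i' + (if isk (pos i') then k else j).+1)%N else 0%N.
pose b : iword := fun i => isk (pos i).
have st i : a (pos i) = true ->
    starts (if b i then k else j) (shift (pos i) a).
  by move=> /ha h; rewrite /b /isk; case: asboolP => // nk; case: h.
have a1 i : a (pos i) = true.
  by elim: i => //= i /st /starts_next; rewrite /shift /b.
exists b.
pose r x y := exists i, x = shift (pos i) a /\ y = iext (tau j k) (shift i b).
apply: (@iword_bisim r); last by exists 0%N.
move=> x y [i [-> ->]]; exists (one_zeros (if b i then k else j)).
exists (shift (pos i.+1) a), (iext (tau j k) (shift i.+1 b)).
split=> //; last by exists i.+1.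
  by rewrite {1}(startsE (st i (a1 i))) shiftD.
by rewrite tau_step {1}/shift addn0 shiftD addn1.
Qed.

(** * The dichotomy *)

(** The condition under which tau_{j,k} renormalizes the order: no other block
    can occur in a dominating word that begins with 1 0^j 1 or 1 0^k 1. *)
Definition two_low (le : rel iword) (j k : nat) : Prop :=
  [/\ (j < k)%N,
      forall a b, starts j a -> starts k b -> slt le a b &
      forall b c, starts k b -> c 0 = true ->
        ~ starts j c -> ~ starts k c -> slt le b c].

(** At most one of the cylinders of 1 0^i 1 lies below 10^oo. *)
Definition one_low (le : rel iword) : Prop :=
  forall i a b, starts i a -> slt le a ten -> b 0 = true -> slt le b ten ->
    starts i b.

Lemma slt01 le a b : cyl le -> slt le zeros ones ->
  a 0 = false -> b 0 = true -> slt le a b.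
Proof.
move=> C lt a0 b0; apply: (slt_agree C lt (n := 0%N)).
- by split=> //; rewrite zerosE onesE.
- by case=> // _; rewrite a0 zerosE.
- by case=> // _; rewrite b0 onesE.
Qed.

Lemma starts_agree2 i a b : starts i a -> starts i b -> agree i.+2 a b.
Proof.
move=> ha hb; apply: agreeS; last by rewrite !starts_next.
by apply: agree_trans ha.1 _; apply: agree_sym; exact: hb.1.
Qed.

Lemma low_block le i a b : cyl le -> starts i a -> slt le a ten ->
  starts i b -> slt le b ten.
Proof.
move=> C ha lt hb; apply: (slt_agree C lt ha) => //.
exact: starts_agree2.
Qed.

Lemma low_slt le i p a b : cyl le -> (i < p)%N -> starts i a ->
  slt le a ten -> starts p b -> slt le a b.
Proof.
move=> C ip ha lt hb; apply: (slt_agree C lt ha) => //.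
by apply: agree_sym; apply: agree_le hb.1.
Qed.

(** Relative to 10^oo, the cylinder of 1 0^i 1 lies entirely below or entirely
    above; those below are increasing in i.  If at least two of them are
    below, the two smallest indices are the two lowest cylinders. *)
Lemma low_dichotomy le : cyl le ->
  one_low le \/ exists j k, two_low le j k.
Proof.
move=> C; pose low i := `[< exists2 a, starts i a & slt le a ten >].
have lowP i a : low i -> starts i a -> slt le a ten.
  by move=> /asboolP[b hb lt]; exact: low_block hb lt.
have [hj|nj] := pselect (exists j, low j); last first.
  by left=> i a b ha lt; case: nj; exists i; apply/asboolP; exists a.
case: (ex_minnP hj) => j lj minj.
have [hk|nk] := pselect (exists k, low k && (k != j)); last first.
  left=> i a b ha lt b0 ltb.
  have eqj p c : starts p c -> slt le c ten -> p = j.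
    move=> hc ltc; have [//|ne] := eqVneq p j; case: nk; exists p.
    by rewrite ne andbT; apply/asboolP; exists c.
  have [p hb] := starts_ex b0 ltb.2.
  by rewrite (eqj i a ha lt) -(eqj p b hb ltb).
case: (ex_minnP hk) => k /andP[lk kj] mink.
have jk : (j < k)%N by rewrite ltn_neqAle eq_sym kj minj.
right; exists j, k; split=> // [a b ha hb|b c hb c0 nj nk].
  exact: low_slt C jk ha (lowP j a lj ha) hb.
have ltb := lowP k b lk hb.
have [->//|ne] := pselect (c = ten).
have [p hp] := starts_ex c0 ne.
case: (neq_slt C ne) => [ltc|]; last exact: slt_trans C ltb.
have kp : (k <= p)%N.
  apply: mink; apply/andP; split; first by apply/asboolP; exists c.
  by apply/eqP => e; rewrite e in hp.
apply: (low_slt C _ hb ltb hp); rewrite ltn_neqAle kp andbT.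
by apply/eqP => e; rewrite -e in hp.
Qed.

Lemma shift_max_zeros le : cyl le -> shift_max le zeros.
Proof. by move=> C n; rewrite shift_zeros; exact: cyl_refl. Qed.

Lemma shift_max_hd0 le a : cyl le -> slt le zeros ones ->
  shift_max le a -> a 0 = false -> a = zeros.
Proof.
move=> C lt ha a0; apply/funext => n; rewrite zerosE; apply/negP => an.
apply: (le_sltF C (ha n)); apply: slt01 => //.
by rewrite /shift addn0.
Qed.

(** The shifts beginning with 0 are smaller because the cylinder of 0 is below
    that of 1. *)
Lemma shift_max_hd1 le a : cyl le -> slt le zeros ones -> a 0 = true ->
  (forall n, a n = true -> le (shift n a) a) -> shift_max le a.
Proof.
move=> C lt a0 h n; case an : (a n); first exact: h.
suff [] : slt le (shift n a) a by [].
by apply: slt01 => //; rewrite /shift addn0.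
Qed.

Lemma per_one_zeros i : per (one_zeros i) =
  wcat (one_zeros i) (per (one_zeros i)).
Proof. exact: perE. Qed.

Lemma shift_max_per le i : cyl le -> slt le zeros ones ->
  shift_max le (per (one_zeros i)).
Proof.
move=> C lt; apply: shift_max_hd1 => // n.
have -> : shift n (per (one_zeros i)) = shift (n %% i.+1) (per (one_zeros i)).
  by apply/funext => p; rewrite /shift /per size_one_zeros modnDml.
rewrite {1}/per size_one_zeros; case: (n %% i.+1)%N => [_|p /=].
  exact: cyl_refl.
by rewrite nth_nseq if_same.
Qed.

Lemma starts_per i : starts i (per (one_zeros i)).
Proof. by rewrite per_one_zeros; exact: starts_wcat. Qed.

Lemma starts_all_per i a : a 0 = true ->
  (forall n, a n = true -> starts i (shift n a)) -> a = per (one_zeros i).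
Proof.
move=> a0 ha.
pose r x y := exists2 n, x = shift n a /\ y = per (one_zeros i) & a n = true.
apply: (@iword_bisim r); last by exists 0%N.
move=> x y [n [-> ->] /ha /[dup] /startsE h /starts_next an].
exists (one_zeros i), (shift i.+1 (shift n a)), (per (one_zeros i)).
split=> //; first exact: per_one_zeros.
by exists (n + i.+1)%N; rewrite ?shiftD.
Qed.

Lemma one_low_shift_max le i a : cyl le -> one_low le -> starts i a ->
  slt le a ten -> shift_max le a -> a = per (one_zeros i).
Proof.
move=> C E ha lt Ma; apply: starts_all_per; first exact: starts0 ha.
move=> n an; apply: (E _ _ _ ha lt); first by rewrite /shift addn0.
exact: le_slt_trans C (Ma n) lt.
Qed.

(** 0^oo is isolated: no other word beginning with 0 dominates its shifts. *)
Lemma acc_hd le x : cyl le -> slt le zeros ones -> acc le x -> x 0 = true.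
Proof.
move=> C lt hx; case x0 : (x 0) => //.
have [a [Ma ne ag]] := hx 1%N; case: ne.
rewrite (shift_max_hd0 C lt (acc_shift_max C hx) x0).
by apply: (shift_max_hd0 C lt Ma); rewrite -ag.
Qed.

Lemma acc_ten le : cyl le -> slt le zeros ones -> acc le ten.
Proof.
move=> C lt n; exists (per (one_zeros n)); split.
- exact: shift_max_per.
- exact: fdiff_neq (starts_per n).
by apply/agree_sym/(agree_le (leqnSn n)); case: (starts_per n).
Qed.

Lemma m_acc (R : realType) le : cyl le -> slt le zeros ones ->
  is_smallest le (acc le) (m_ R le).
Proof. by move=> C lt; apply: m_smallest => //; exists ten; exact: acc_ten. Qed.

Lemma m_hd (R : realType) le : cyl le -> slt le zeros ones ->
  m_ R le 0 = true.
Proof. by move=> C lt; case: (m_acc R C lt) => + _; exact: acc_hd. Qed.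

(** A dominating word below 10^oo has all its blocks in the only cylinder
    available, so it is periodic; thus each such word is isolated. *)
Lemma one_low_m (R : realType) le : cyl le -> slt le zeros ones ->
  one_low le -> m_ R le = ten.
Proof.
move=> C lt E; apply: m_uniq => //; split; first exact: acc_ten.
move=> x hx; have [//|/negP/(nle_slt C) ltx] := boolP (le ten x).
have Mx := acc_shift_max C hx.
have [i hi] := starts_ex (acc_hd C lt hx) ltx.2.
have [a [Ma ne ag]] := hx i.+2.
have ha := starts_agree hi ag.
case: ne; rewrite (one_low_shift_max C E hi ltx Mx).
exact: one_low_shift_max (low_block C hi ltx ha) Ma.
Qed.

Definition below (le : rel iword) (m : iword) : set iword :=
  [set a | shift_max le a /\ slt le a m].

Lemma one_low_below le a : cyl le -> slt le zeros ones -> one_low le ->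
  below le ten a <-> a = zeros \/
    exists j, a = per (one_zeros j) /\ slt le a ten.
Proof.
move=> C lt E; split=> [[Ma lta]|].
  case a0 : (a 0); last by left; exact: shift_max_hd0 C lt Ma a0.
  have [i hi] := starts_ex a0 lta.2.
  by right; exists i; split=> //; exact: one_low_shift_max hi lta Ma.
case=> [->|[j [e ltj]]]; split=> //.
- exact: shift_max_zeros.
- by apply: slt01 => //; exact: zerosE.
by rewrite e; exact: shift_max_per.
Qed.

Lemma one_low_uniq le j p : one_low le ->
  slt le (per (one_zeros j)) ten -> slt le (per (one_zeros p)) ten -> j = p.
Proof.
move=> E hj hp.
apply: (@starts_uniq _ _ (per (one_zeros p))); last exact: starts_per.
by apply: E (starts_per j) hj _ hp.
Qed.

(** * Renormalization *)

Definition pull (j k : nat) (le : rel iword) : rel iword :=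
  fun a b => le (iext (tau j k) a) (iext (tau j k) b).

Lemma slt_pull j k le a b : (j < k)%N ->
  slt (pull j k le) a b <-> slt le (iext (tau j k) a) (iext (tau j k) b).
Proof.
move=> jk; split=> -[ab ne]; split=> //; first by move/(tau_inj jk).
by move=> e; apply: ne; rewrite e.
Qed.

Lemma cyl_pull j k le : (j < k)%N -> cyl le -> cyl (pull j k le).
Proof.
move=> jk C; split; first split.
- by move=> a; exact: (cyl_refl _ C).
- by move=> a b /andP[ab ba]; apply: (tau_inj jk); exact: cyl_anti C ab ba.
- by move=> b a c; exact: (cyl_trans C).
- by move=> a b; case: C => -[_ _ _ tot] _; exact: tot.
move=> a b c n ab bc ac; case: (agree_or_fdiff n a b) => // -[i hi d].
have ac' := tau_agree jk (agree_le hi ac); rewrite addnS in ac'.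
have := fdiff_agreeF (tau_fdiff jk d) (C.2 _ _ _ _ ab bc ac').
by rewrite ltnn.
Qed.

Lemma pull_lt01 j k le : two_low le j k -> slt (pull j k le) zeros ones.
Proof.
case=> jk lt _; apply/(slt_pull _ _ _ jk); apply: lt.
  by have := tau_starts j k zeros; rewrite zerosE.
by have := tau_starts j k ones; rewrite onesE.
Qed.

Lemma two_low_lt le j k a b : cyl le -> two_low le j k -> a 0 = true ->
  b 0 = true -> slt le a (iext (tau j k) b) -> starts j a \/ starts k a.
Proof.
move=> C [_ _ hi] a0 b0 lt; apply: contrapT => h; case: (lt) => ab _.
apply: (le_sltF C ab); apply: hi => //.
- by have := tau_starts j k b; rewrite b0.
- by move=> ?; apply: h; left.
- by move=> ?; apply: h; right.
Qed.

(** All blocks of [a] lie below its first block or equal it, and no cylinder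
    is lower than those of 1 0^j 1 and 1 0^k 1; so only these blocks occur. *)
Lemma shift_max_desubst le j k a : cyl le -> two_low le j k ->
  shift_max le a -> starts j a \/ starts k a ->
  exists2 b, shift_max (pull j k le) b & a = iext (tau j k) b.
Proof.
move=> C [jk lt hi] Ma sa.
have sn n : a n = true -> starts j (shift n a) \/ starts k (shift n a).
  move=> an; apply: contrapT => h.
  have nj : ~ starts j (shift n a) by move=> ?; apply: h; left.
  have nk : ~ starts k (shift n a) by move=> ?; apply: h; right.
  have an0 : shift n a 0 = true by rewrite /shift addn0.
  apply: (le_sltF C (Ma n)); case: sa => sa; last exact: hi.
  have sk : starts k (wcat (one_zeros k) ones).
    by apply: starts_wcat; rewrite onesE.
  exact: slt_trans C (lt _ _ sa sk) (hi _ _ sk an0 nj nk).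
have a0 : a 0 = true by case: sa => /starts0.
have [b eb] := tau_image a0 sn; exists b => // n.
rewrite /pull; have [p <-] := tau_shift j k b n.
by rewrite -eb.
Qed.

Lemma shift_max_tau le j k b : cyl le -> slt le zeros ones ->
  shift_max (pull j k le) b -> shift_max le (iext (tau j k) b).
Proof.
move=> C lt Mb; apply: shift_max_hd1 => //; first exact: tau_hd.
by move=> n /shift_tau[i ->]; exact: Mb.
Qed.

Lemma acc_tau le j k x : (j < k)%N -> cyl le -> slt le zeros ones ->
  acc (pull j k le) x -> acc le (iext (tau j k) x).
Proof.
move=> jk C lt hx n; have [a [Ma ne ag]] := hx n.
exists (iext (tau j k) a); split; first exact: shift_max_tau.
  by move/(tau_inj jk).
by apply: agree_le (tau_agree_le jk ag).
Qed.

(** The words that accumulate at [x] share its first block, so they are images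
    as well. *)
Lemma acc_desubst le j k x : cyl le -> two_low le j k -> acc le x ->
  starts j x \/ starts k x ->
  exists2 y, acc (pull j k le) y & x = iext (tau j k) y.
Proof.
move=> C T hx sx; have [jk _ _] := T.
have [y My ey] := shift_max_desubst C T (acc_shift_max C hx) sx.
exists y => // n; have [a [Ma ne ag]] := hx (k.+2 + k.+1 * n)%N.
have sa : starts j a \/ starts k a.
  by case: sx => sx; [left|right]; apply: (starts_agree sx);
     apply: agree_le ag; lia.
have [b Mb eb] := shift_max_desubst C T Ma sa; exists b; split=> //.
  by move=> e; apply: ne; rewrite eb ey e.
apply: (tau_agree_inv jk); rewrite -ey -eb; apply: agree_le ag; lia.
Qed.

(** The dominating words below the image of the new m begin with 0, 1 0^j 1 or
    1 0^k 1; the first kind contributes only the isolated point 0^oo, the others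
    are images. *)
Lemma two_low_m (R : realType) le j k : cyl le -> slt le zeros ones ->
  two_low le j k -> m_ R le = iext (tau j k) (m_ R (pull j k le)).
Proof.
move=> C lt T; have [jk _ _] := T.
have C' := cyl_pull jk C; have lt' := pull_lt01 T.
have [mac mmin] := m_acc R C' lt'.
apply: m_uniq => //; split; first exact: acc_tau.
move=> x hx; have [//|/negP/(nle_slt C) ltx] :=
  boolP (le (iext (tau j k) (m_ R (pull j k le))) x).
have sx := two_low_lt C T (acc_hd C lt hx) (m_hd R C' lt') ltx.
have [y hy ey] := acc_desubst C T hx sx.
by case: (le_sltF C _ ltx); rewrite ey; exact: mmin.
Qed.

Lemma two_low_below le j k m a : cyl le -> slt le zeros ones ->
  two_low le j k -> m 0 = true ->
  below le (iext (tau j k) m) a <->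
  a = zeros \/ exists2 b, below (pull j k le) m b & a = iext (tau j k) b.
Proof.
move=> C lt T m0; have [jk _ _] := T; split=> [[Ma lta]|].
  case a0 : (a 0); last by left; exact: shift_max_hd0 C lt Ma a0.
  right; have [b Mb eb] :=
    shift_max_desubst C T Ma (two_low_lt C T a0 m0 lta).
  by exists b => //; split=> //; apply/(slt_pull _ _ _ jk); rewrite -eb.
case=> [->|[b [Mb ltb] ->]]; split.
- exact: shift_max_zeros.
- by apply: (slt01 C lt); rewrite ?zerosE ?tau_hd.
- exact: shift_max_tau.
- exact/slt_pull.
Qed.

(** The second letter is 0 because k > j >= 0 in tau_{j,k}. *)
Lemma m_snd (R : realType) le : cyl le -> slt le zeros ones ->
  m_ R le 1 = false.
Proof.
move=> C lt; case: (low_dichotomy C) => [E|[j [k T]]].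
  by rewrite one_low_m // tenS.
have [jk _ _] := T; rewrite (two_low_m R C lt T) tau_step.
rewrite (m_hd R (cyl_pull jk C) (pull_lt01 T)) wcat_lt ?size_one_zeros.
  by case: k jk {T}.
by case: k jk {T}.
Qed.

(** By uniqueness of the decomposition, knowing m as the image of a word
    beginning with 10 identifies which case of the dichotomy holds. *)
Lemma m_tau_inv (R : realType) le j k x : cyl le -> slt le zeros ones ->
  (j < k)%N -> x 0 = true -> x 1 = false -> m_ R le = iext (tau j k) x ->
  two_low le j k /\ x = m_ R (pull j k le).
Proof.
move=> C lt jk x0 x1 e; case: (low_dichotomy C) => [E|[j' [k' T]]].
  by case: (@tau_neq_ten j k x); rewrite -e one_low_m.
have [jk' _ _] := T; have C' := cyl_pull jk' C; have lt' := pull_lt01 T.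
have := two_low_m R C lt T; rewrite e => /(tau_decomp jk jk' x0 x1).
by case; [exact: m_hd|exact: m_snd|move=> -> -> ->].
Qed.

(** * Compositions and limit words *)

Definition tl (s : nat -> subst) : nat -> subst := fun n => s n.+1.

Lemma scompS s n : scomp s n.+1 = s 0 \o scomp (tl s) n.
Proof. by elim: n => // n IH; rewrite -[LHS]/(scomp s n.+1 \o _) IH. Qed.

Lemma S_nonerasing sigma :
  S_ sigma -> exists2 f, nonerasing f & sigma = morph f.
Proof.
move=> [j [k [_ ->]]].
by exists (fun x => if x then one_zeros k else one_zeros j); first by case.
Qed.

Lemma Sstar_nonerasing sigma :
  Sstar sigma -> exists2 f, nonerasing f & sigma = morph f.
Proof.
elim=> [|{}sigma /S_nonerasing //|s1 s2 _ [f hf ->] _ [g hg ->]].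
  by exists (fun x => [:: x]); [case|exact: morph_id].
by exists (morph f \o g); [exact: nonerasing_comp|exact: morph_comp].
Qed.

Lemma iext_Sstar_comp s1 s2 a : Sstar s1 -> Sstar s2 ->
  iext (s1 \o s2) a = iext s1 (iext s2 a).
Proof.
move=> /Sstar_nonerasing[f hf ->] /Sstar_nonerasing[g hg ->].
exact: iext_comp.
Qed.

Lemma scomp_Sstar s n : (forall i, (i < n)%N -> S_ (s i)) -> Sstar (scomp s n).
Proof.
elim: n => [|n IH] hs /=; first exact: Sstar_id.
apply: Sstar_comp; last by apply/Sstar_gen/hs.
by apply: IH => i hi; apply: hs; exact: ltnW.
Qed.

Lemma tl_S s n : (forall i, (i < n.+1)%N -> S_ (s i)) ->
  forall i, (i < n)%N -> S_ (tl s i).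
Proof. by move=> hs i hi; apply: hs. Qed.

Lemma tl_Sinf s : Sinf s -> Sinf (tl s).
Proof. by move=> hs i; exact: hs. Qed.

Lemma iext_scompS s n a : (forall i, (i < n.+1)%N -> S_ (s i)) ->
  iext (scomp s n.+1) a = iext (s 0) (iext (scomp (tl s) n) a).
Proof.
move=> hs; rewrite scompS iext_Sstar_comp //.
  by apply: Sstar_gen; exact: hs.
exact/scomp_Sstar/tl_S.
Qed.

Lemma per_scompS s n : (forall i, (i < n.+1)%N -> S_ (s i)) ->
  per (scomp s n.+1 [:: false]) =
  iext (s 0) (per (scomp (tl s) n [:: false])).
Proof.
move=> hs; rewrite scompS /=.
have [f hf ->] := S_nonerasing (hs 0%N isT); rewrite iext_per // => e.
have [g hg eg] := Sstar_nonerasing (scomp_Sstar (tl_S hs)).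
by have := size_morph [:: false] hg; rewrite -eg e.
Qed.

Lemma tau_snd j k a : (j < k)%N -> a 0 = true -> iext (tau j k) a 1 = false.
Proof. by move=> + a0; rewrite tau_step a0; case: k. Qed.

Lemma iext_scomp_hd s n a : (forall i, (i < n)%N -> S_ (s i)) ->
  a 0 = true -> iext (scomp s n) a 0 = true.
Proof.
case: n => [|n] hs a0; first by rewrite iext_id.
rewrite iext_scompS //; have [j [k [_ ->]]] := hs 0%N isT.
exact: tau_hd.
Qed.

Lemma iext_scomp_snd s n a : (forall i, (i < n)%N -> S_ (s i)) ->
  a 0 = true -> a 1 = false -> iext (scomp s n) a 1 = false.
Proof.
case: n => [|n] hs a0 a1; first by rewrite iext_id.
rewrite iext_scompS //; have [j [k [jk ->]]] := hs 0%N isT.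
by apply: (tau_snd jk); apply: iext_scomp_hd => //; exact: tl_S.
Qed.

Lemma agree_scomp s n p a b : Sinf s -> (n <= p)%N ->
  agree n (iext (scomp s n) a) (iext (scomp s p) b).
Proof.
elim: n p s => // n IH [//|p] s hs np; rewrite !iext_scompS //.
have [j [k [jk ->]]] := hs 0%N.
by apply: (tau_agree_le jk); apply: IH => //; exact: tl_Sinf.
Qed.

(** The first n letters are already determined by n substitutions, whatever word
    they are applied to. *)
Lemma limit_agree (R : realType) s n a : Sinf s ->
  agree n (limit_word R s) (iext (scomp s n) a).
Proof.
move=> hs; have : converges_to R (fun n => iext (scomp s n) ones)
    (limit_word R s).
  apply: xgetPex; exists (fun n => iext (scomp s n.+1) ones n).
  apply/converges_toP => p; exists p => q pq i ip.
  by apply/esym/(agree_scomp _ _ hs) => //; exact: leq_trans pq.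
move=> /converges_toP/(_ n)[N hN].
apply: agree_trans (agree_sym (hN (maxn n N) (leq_maxr _ _))) _.
by apply/agree_sym/(agree_scomp _ _ hs)/leq_maxl.
Qed.

Lemma limit_uniq (R : realType) s m : Sinf s ->
  (forall n, exists a, m = iext (scomp s n) a) -> m = limit_word R s.
Proof.
move=> hs hm; apply: agree_eq => n; have [a ->] := hm n.
exact/agree_sym/limit_agree.
Qed.

Lemma limit_step (R : realType) s : Sinf s ->
  limit_word R s = iext (s 0) (limit_word R (tl s)).
Proof.
move=> hs; apply: agree_eq => n; have hs' := tl_Sinf hs.
apply: agree_trans (limit_agree R (n := n) zeros hs) _.
case: n => // n; rewrite iext_scompS //; have [j [k [jk ->]]] := hs 0%N.
by apply: (tau_agree_le jk); exact/agree_sym/limit_agree.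
Qed.

Lemma limit_hd (R : realType) s : Sinf s -> limit_word R s 0 = true.
Proof.
move=> hs; rewrite limit_step //; have [j [k [jk ->]]] := hs 0%N.
exact: tau_hd.
Qed.

Lemma limit_snd (R : realType) s : Sinf s -> limit_word R s 1 = false.
Proof.
move=> hs; rewrite limit_step //; have [j [k [jk ->]]] := hs 0%N.
exact/tau_snd/limit_hd/tl_Sinf.
Qed.

(** * The words below m *)

(** Induction on a bound for the common prefix with m, which desubstitution
    shortens. *)
Lemma below_limit_sub (R : realType) N le s a : cyl le -> slt le zeros ones ->
  Sinf s -> m_ R le = limit_word R s -> below le (m_ R le) a ->
  ~ agree N a (m_ R le) -> exists n, a = per (scomp s n [:: false]).
Proof.
elim: N le s a => [|N IH] le s a C lt hs; first by move=> _ _ [].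
have hs' := tl_Sinf hs; rewrite limit_step //.
have [j [k [jk e0]]] := hs 0%N; rewrite e0.
move=> /(m_tau_inv C lt jk (limit_hd R hs') (limit_snd R hs'))[T em].
rewrite (two_low_m R C lt T).
have m0 := m_hd R (cyl_pull jk C) (pull_lt01 T).
move=> /(two_low_below _ C lt T m0)[->|[b bb ->] nag]; first by exists 0%N.
have [|n ->] := IH _ _ b (cyl_pull jk C) (pull_lt01 T) hs' (esym em) bb.
  by move=> /(tau_agree_le jk).
by exists n.+1; rewrite per_scompS // e0.
Qed.

Lemma below_limit_sup (R : realType) n le s : cyl le -> slt le zeros ones ->
  Sinf s -> m_ R le = limit_word R s ->
  below le (m_ R le) (per (scomp s n [:: false])).
Proof.
elim: n le s => [|n IH] le s C lt hs.
  move=> _; split; first exact: shift_max_zeros.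
  by apply: (slt01 C lt); rewrite ?zerosE ?m_hd.
have hs' := tl_Sinf hs; rewrite limit_step // per_scompS //.
have [j [k [jk e0]]] := hs 0%N; rewrite e0.
move=> /(m_tau_inv C lt jk (limit_hd R hs') (limit_snd R hs'))[T em].
rewrite (two_low_m R C lt T).
have m0 := m_hd R (cyl_pull jk C) (pull_lt01 T).
apply/(two_low_below _ C lt T m0); right.
by eexists; [apply: IH (cyl_pull jk C) (pull_lt01 T) hs' (esym em)|].
Qed.

Lemma below_limit (R : realType) le s a : cyl le -> slt le zeros ones ->
  Sinf s -> m_ R le = limit_word R s ->
  below le (m_ R le) a <-> exists n, a = per (scomp s n [:: false]).
Proof.
move=> C lt hs em; split=> [ba|[n ->]]; last exact: below_limit_sup.
have [n [_ d]] := neq_fdiff ba.2.2.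
apply: (@below_limit_sub R n.+1 le) => // h; apply: d.
exact: h.
Qed.

(** Each [two_low] step contributes 0^oo and images of the words below the next
    m; the words (1 0^j)^oo come from the last order, in which m is 10^oo. *)
Lemma below_ten_image (R : realType) h le s : cyl le -> slt le zeros ones ->
  (forall n, (n < h)%N -> S_ (s n)) -> m_ R le = iext (scomp s h) ten ->
  (forall a, below le (m_ R le) a <->
    (exists n, (n <= h)%N /\ a = per (scomp s n [:: false])) \/
    (exists j, a = iext (scomp s h) (per (one_zeros j)) /\
               slt le a (m_ R le))) /\
  (forall j j',
    slt le (iext (scomp s h) (per (one_zeros j))) (m_ R le) ->
    slt le (iext (scomp s h) (per (one_zeros j'))) (m_ R le) -> j = j').
Proof.
elim: h le s => [|h IH] le s C lt hs.
  rewrite !iext_id => em; have E : one_low le.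
    case: (low_dichotomy C) => // -[j [k T]].
    by case: (@tau_neq_ten j k (m_ R (pull j k le))); rewrite -two_low_m.
  rewrite em; split=> [a|j j']; last by rewrite !iext_id; exact: one_low_uniq.
  split=> [/(one_low_below _ C lt E)|].
    case=> [->|[j [e lta]]]; first by left; exists 0%N.
    by right; exists j; rewrite iext_id.
  case=> [[n []]|[j [e lta]]].
    by rewrite leqn0 => /eqP -> ->; apply/(one_low_below _ C lt E); left.
  apply/(one_low_below _ C lt E); right; exists j.
  by rewrite {1}e iext_id.
have hs' := tl_S hs; rewrite iext_scompS //.
have [j [k [jk e0]]] := hs 0%N isT; rewrite e0.
move=> /(m_tau_inv C lt jk (iext_scomp_hd hs' ten0)
                           (iext_scomp_snd hs' ten0 (tenS 0)))[T em].
have C' := cyl_pull jk C; have lt' := pull_lt01 T.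
have [IH1 IH2] := IH _ _ C' lt' hs' (esym em).
rewrite (two_low_m R C lt T); split=> [a|i i']; last first.
  rewrite !iext_scompS // e0 => /(slt_pull le _ _ jk) h1 /(slt_pull le _ _ jk).
  exact: IH2.
have m0 := m_hd R C' lt'; split=> [/(two_low_below _ C lt T m0)|].
  case=> [->|[b /IH1 bb ->]]; first by left; exists 0%N.
  case: bb => [[n [nh ->]]|[i [-> lti]]].
    left; exists n.+1; split=> //; rewrite per_scompS ?e0 // => p pn.
    by apply: hs; exact: leq_trans nh.
  right; exists i; rewrite iext_scompS // e0; split=> //.
  exact/slt_pull.
case=> [[[|n] [nh ->]]|[i [ea lta]]]; apply/(two_low_below _ C lt T m0).
- by left.
- right; exists (per (scomp (tl s) n [:: false])).
    by apply/IH1; left; exists n.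
  by rewrite per_scompS ?e0 // => p pn; apply: hs; exact: leq_trans nh.
rewrite iext_scompS // e0 in ea; right; eexists; last exact: ea.
apply/IH1; right; exists i; split=> //.
by apply/(slt_pull _ _ _ jk); rewrite -ea.
Qed.

(** * Every m comes from a substitution or a sequence of substitutions *)

Lemma m_characterization (R : realType) le : cyl le -> slt le zeros ones ->
  (exists2 sigma, Sstar sigma & m_ R le = iext sigma ten) \/
  (exists2 s, Sinf s & m_ R le = limit_word R s).
Proof.
move=> C lt; apply: contrapT => /not_orP[nfin]; apply.
have two r : exists jk, (exists j k, two_low r j k) -> two_low r jk.1 jk.2.
  have [[j [k h]]|] := pselect (exists j k, two_low r j k).
    by exists (j, k).
  by exists (0, 0)%N.
have [g hg] := choice two.
pose les := fix les n :=
  if n is n'.+1 then pull (g (les n')).1 (g (les n')).2 (les n') else le.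
pose s n := tau (g (les n)).1 (g (les n)).2.
have inv n : [/\ cyl (les n), slt (les n) zeros ones,
    (forall i, (i < n)%N -> S_ (s i)) &
    m_ R le = iext (scomp s n) (m_ R (les n))] /\
    two_low (les n) (g (les n)).1 (g (les n)).2.
  elim: n => [|n [[Cn ltn hs em] T]].
    split; first by split=> //; rewrite iext_id.
    apply: hg; case: (low_dichotomy C) => // E; case: nfin.
    by exists id; [exact: Sstar_id|rewrite iext_id one_low_m].
  have [jk _ _] := T.
  have hs' i : (i < n.+1)%N -> S_ (s i).
    rewrite ltnS leq_eqVlt => /orP[/eqP ->|]; last exact: hs.
    by exists (g (les n)).1, (g (les n)).2.
  have C' : cyl (les n.+1) by exact: cyl_pull.
  have lt' : slt (les n.+1) zeros ones by exact: pull_lt01.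
  have em' : m_ R le = iext (scomp s n.+1) (m_ R (les n.+1)).
    rewrite em (two_low_m R Cn ltn T) /= iext_Sstar_comp //.
      exact: scomp_Sstar.
    by apply: Sstar_gen; exact: hs'.
  split=> //; apply: hg; case: (low_dichotomy C') => // E; case: nfin.
  by exists (scomp s n.+1); [exact: scomp_Sstar|rewrite em' (one_low_m R C')].
have hs : Sinf s by move=> n; have [[_ _ h _] _] := inv n.+1; exact: h.
exists s => //; apply: limit_uniq => // n; have [[_ _ _ h] _] := inv n.
by exists (m_ R (les n)).
Qed.

(** * Orders with a prescribed m *)

(** To prescribe which words are below a given word, it suffices to choose the
    smaller letter at each position, irrespective of the prefix. *)
Definition lex_by (g : nat -> bool) : rel iword :=
  fun a b => `[< a = b \/ exists2 n, fdiff n a b & a n = g n >].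

Lemma cyl_lex_by g : cyl (lex_by g).
Proof.
split; first split.
- by move=> a; apply/asboolP; left.
- move=> a b /andP[/asboolP[//|[n d an]] /asboolP[//|[p d' bp]]].
  have e := fdiff_uniq (fdiff_sym d') d; case: d => _; case.
  by rewrite an -e -bp.
- move=> b a c /asboolP[->//|[n d an]] /asboolP[<-|[p d' bp]].
    by apply/asboolP; right; exists n.
  apply/asboolP; right; case: (ltngtP n p) => np.
  + exists n => //; apply: fdiff_agree d _ _ => //.
    exact: agree_le np d'.1.
  + exists p; last by rewrite d.1.
    apply: fdiff_agree d' _ _ => //; apply: agree_sym.
    exact: agree_le np d.1.
  + by case: d => _; case; rewrite an np bp.
- move=> a b; have [->|/neq_fdiff[n d]] := pselect (a = b).
    by apply/orP; left; apply/asboolP; left.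
  have [e|ne] := eqVneq (a n) (g n); apply/orP; [left|right]; apply/asboolP;
    right; exists n => //; first exact: fdiff_sym.
  apply: neq_letters (_ : _ <> a n) _; first by move/esym; case: d.
  by apply/eqP; rewrite eq_sym.
move=> a b c n /asboolP[->//|[p d ap]] /asboolP[->//|[q d' bq]] ac.
case: (leqP n p) => np; first exact: agree_le d.1.
case: d d' => ab nab [bc nbc]; case: (ltngtP p q) => pq.
- by case: nab; rewrite bc // ac.
- by case: nbc; rewrite -ab // ac //; exact: ltn_trans np.
- by case: nab; rewrite ap pq bq.
Qed.

Lemma slt_lex_by g n a b : fdiff n a b -> slt (lex_by g) a b <-> a n = g n.
Proof.
move=> d; split=> [[/asboolP[//|[p d' ap]] _]|an].
  by rewrite (fdiff_uniq d d').
by split; [apply/asboolP; right; exists n|exact: fdiff_neq d].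
Qed.

(** The words below [m] form a union of cylinders that branch off from [m]; here
    [P] contains a witness for each position where this happens. *)
Definition adapted (le : rel iword) (m : iword) (P : set iword) : Prop :=
  forall a n, fdiff n a m -> slt le a m <-> exists2 p, P p & fdiff n p m.

Lemma adapted_exists m P : exists2 le, cyl le & adapted le m P.
Proof.
pose D n := `[< exists2 p, P p & fdiff n p m >].
pose g n := if D n then ~~ m n else m n.
exists (lex_by g); first exact: cyl_lex_by.
move=> a n d; rewrite (slt_lex_by _ d) /g.
case: (asboolP _ : reflect _ (D n)) => h; split=> //.
  by move=> _; case: d => _; case: (a n); case: (m n).
by move=> e; case: d => _; rewrite e.
Qed.

Lemma adapted_lt01 le m (P : set iword) : cyl le -> adapted le m P ->
  P zeros -> m 0 = true -> slt le zeros ones.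
Proof.
move=> C A P0 m0.
have d : fdiff 0 zeros m by split=> //; rewrite m0 zerosE.
have lt : slt le zeros m by apply/(A _ _ d); exists zeros.
by apply: (slt_agree C lt d) => // -[|//] _; rewrite onesE m0.
Qed.

Lemma size_tau_mkseq j k a n p : (n < p)%N ->
  (size (tau j k (mkseq a n)) < size (tau j k (mkseq a p)))%N.
Proof.
move=> /subnKC <-; rewrite addSnnS mkseqD {2}/tau morph_cat -/(tau j k).
rewrite size_cat -addn1 leq_add2l; apply: leq_trans (size_tau j k _).
by rewrite size_mkseq.
Qed.

(** If a word of [Q] begins with 0, its image branches off from that of [m]
    right after 1 0^j; otherwise the two images share the prefix 1 0^k 1.  So
    1 0^j 1 is the only cylinder of its kind below the one of 1 0^k 1. *)
Lemma adapted_tau le j k m (P Q : set iword) : (j < k)%N -> cyl le ->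
  m 0 = true -> Q zeros ->
  (forall p, P p <-> p = zeros \/ exists2 q, Q q & p = iext (tau j k) q) ->
  adapted le (iext (tau j k) m) P ->
  two_low le j k /\ adapted (pull j k le) m Q.
Proof.
move=> jk C m0 Q0 PE A.
have sm : starts k (iext (tau j k) m) by have := tau_starts j k m; rewrite m0.
have s0 : starts j (iext (tau j k) zeros).
  by have := tau_starts j k zeros; rewrite zerosE.
split; last first.
  move=> a n d; rewrite (slt_pull _ _ _ jk) (A _ _ (tau_fdiff jk d)).
  split=> [[p /PE[->|[q Qq ->]] dp]|[q Qq dq]].
  - have : fdiff 0 zeros (iext (tau j k) m).
      by split=> //; rewrite zerosE tau_hd.
    by move/(fdiff_uniq dp); rewrite addnS.
  - exists q => //.
    have [e|/neq_fdiff[r d']] := pselect (q = m).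
      by case: (fdiff_neq dp); rewrite e.
    suff -> : n = r by [].
    have := fdiff_uniq dp (tau_fdiff jk d').
    rewrite (agree_mkseq d.1) (agree_mkseq d'.1) => /addIn e.
    by case: (ltngtP n r) => // /(size_tau_mkseq j k m); rewrite e ltnn.
  - exists (iext (tau j k) q); first by apply/PE; right; exists q.
    rewrite (agree_mkseq d.1) -(agree_mkseq dq.1).
    exact: tau_fdiff.
split=> // [a b ha hb|b c hb c0 nj nk].
  have lt : slt le a (iext (tau j k) m).
    apply/(A _ _ (starts_fdiff jk ha sm)); exists (iext (tau j k) zeros).
      by apply/PE; right; exists zeros.
    exact: starts_fdiff jk s0 sm.
  apply: (slt_agree C lt (starts_fdiff jk ha sm)) => //.
  apply: agree_le (starts_agree2 sm hb); lia.
have ne : c <> iext (tau j k) m by move=> e; apply: nk; rewrite e.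
have [n d] := neq_fdiff ne.
have nk' : (n <= k.+1)%N.
  rewrite leqNgt; apply/negP => kn; apply: nk; apply: (starts_agree sm).
  by apply/agree_sym/(agree_le kn d.1).
have n0 : n <> 0%N by move=> e; case: d => _; rewrite e c0 tau_hd.
have nj' : n <> j.+1.
  move=> e; apply: nj; rewrite e in d; apply: (fdiff_agree d) => //.
  exact: agree_le sm.1.
have lt : slt le (iext (tau j k) m) c.
  case: (neq_slt C ne) => // /(A _ _ d)[p /PE[->|[q Qq ->]] dp].
    case: n0; apply: (fdiff_uniq dp); split=> //.
    by rewrite zerosE tau_hd.
  have := tau_starts j k q; case: (q 0) => sq.
    by have := fdiff_agreeF dp (starts_agree2 sq sm); rewrite ltnNge nk'.
  by case: nj'; exact: fdiff_uniq dp (starts_fdiff jk sq sm).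
apply: (slt_agree C lt (fdiff_sym d)) => //.
exact: agree_le (starts_agree2 sm hb).
Qed.

(** Quantifying over all adapted orders makes induction possible: the pullback
    of an order from [adapted_exists] is adapted but need not have that form. *)
Definition realizable (R : realType) (m : iword) : Prop := exists P,
  [/\ P zeros, m 0 = true & forall le, cyl le -> adapted le m P -> m_ R le = m].

(** With 0^oo as the only witness, no word beginning with 1 is below 10^oo. *)
Lemma realizable_ten (R : realType) : realizable R ten.
Proof.
exists [set zeros]; split=> // le C A.
have lt := adapted_lt01 C A (erefl _) ten0.
apply: one_low_m => // i a b ha /(A _ _ ha)[p -> [/(_ 0%N isT)]].
by rewrite zerosE.
Qed.

Lemma realizable_tau (R : realType) j k m : (j < k)%N ->
  realizable R m -> realizable R (iext (tau j k) m).
Proof.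
move=> jk [Q [Q0 m0 hQ]].
pose P p := p = zeros \/ exists2 q, Q q & p = iext (tau j k) q.
exists P; split; [by left|exact: tau_hd|] => le C A.
have [T A'] := adapted_tau jk C m0 Q0 (fun p => iff_refl (P p)) A.
have lt := adapted_lt01 C A (or_introl (erefl _)) (tau_hd j k m).
by rewrite (two_low_m R C lt T) (hQ _ (cyl_pull jk C) A').
Qed.

Lemma realizable_Sstar (R : realType) sigma m : Sstar sigma ->
  realizable R m -> realizable R (iext sigma m).
Proof.
move=> h; elim: h m => {sigma} [m|sigma [j [k [jk ->]]] m|].
- by rewrite iext_id.
- exact: realizable_tau.
by move=> s1 s2 h1 IH1 h2 IH2 m /IH2/IH1; rewrite iext_Sstar_comp.
Qed.

Definition pers (s : nat -> subst) : set iword :=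
  [set a | exists n, a = per (scomp s n [:: false])].

Lemma pers_zeros s : pers s zeros.
Proof. by exists 0%N. Qed.

Lemma pers_step s p : Sinf s ->
  pers s p <-> p = zeros \/ exists2 q, pers (tl s) q & p = iext (s 0) q.
Proof.
move=> hs; split=> [[[|n] ->]|[->|[q [n ->] ->]]].
- by left.
- by right; rewrite per_scompS //; eexists; first by exists n.
- exact: pers_zeros.
by exists n.+1; rewrite per_scompS.
Qed.

Lemma realizable_limit (R : realType) s : Sinf s ->
  realizable R (limit_word R s).
Proof.
move=> hs; exists (pers s); split; [exact: pers_zeros|exact: limit_hd|].
move=> le C A; apply: agree_eq => n; elim: n le s hs C A => // n IH le s hs C A.
have hs' := tl_Sinf hs.
have lt := adapted_lt01 C A (pers_zeros s) (limit_hd R hs).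
move: A; rewrite limit_step //; have [j [k [jk e0]]] := hs 0%N.
rewrite e0 => A.
have PE p := pers_step p hs; rewrite e0 in PE.
have [T A'] := adapted_tau jk C (limit_hd R hs') (pers_zeros (tl s)) PE A.
rewrite (two_low_m R C lt T); apply: (tau_agree_le jk).
by apply: IH => //; exact: cyl_pull.
Qed.

Lemma realizableP (R : realType) m : realizable R m -> exists le,
  [/\ cylinder_order R le, slt le zeros ones & m = m_ R le].
Proof.
move=> [P [P0 m0 h]]; have [le C A] := adapted_exists m P.
exists le; split; [exact/cylinder_orderP|exact: adapted_lt01 A P0 m0|].
by rewrite (h le).
Qed.

Theorem theorem3 (R : realType) :
  (forall m : iword,
     (exists le : rel iword,
        [/\ cylinder_order R le, slt le zeros ones & m = m_ R le])
     <->
     ((exists sigma : subst,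
         Sstar sigma /\ m = iext sigma (wcat [:: true] zeros)) \/
      (exists s : nat -> subst, Sinf s /\ m = limit_word R s)))
  /\
  (forall le : rel iword, cylinder_order R le -> slt le zeros ones ->
     (forall s : nat -> subst, Sinf s -> m_ R le = limit_word R s ->
        [set a | M_ le a /\ slt le a (m_ R le)] =
        [set a | exists n : nat, a = per (scomp s n [:: false])])
     /\
     (forall (h : nat) (s : nat -> subst),
        (forall n : nat, (n < h)%N -> S_ (s n)) ->
        m_ R le = iext (scomp s h) (wcat [:: true] zeros) ->
        [set a | M_ le a /\ slt le a (m_ R le)] =
        [set a | exists n : nat, (n <= h)%N /\ a = per (scomp s n [:: false])]
        `|`
        [set a | exists j : nat, a = iext (scomp s h) (per (one_zeros j)) /\
                                 slt le a (m_ R le)]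
        /\
        (forall j j' : nat,
           slt le (iext (scomp s h) (per (one_zeros j))) (m_ R le) ->
           slt le (iext (scomp s h) (per (one_zeros j'))) (m_ R le) ->
           j = j'))).
Proof.
have belowE le m a : cyl le -> (M_ le a /\ slt le a m) <-> below le m a.
  by move=> C; split=> -[/(M_E _ C)].
split=> [m|le /cylinder_orderP C lt]; first split.
- move=> [le [/cylinder_orderP C lt ->]].
  by case: (m_characterization R C lt) => -[sigma h e];
     [left|right]; exists sigma.
- case=> -[sigma [h ->]]; apply: realizableP; last exact: realizable_limit.
  exact: realizable_Sstar (realizable_ten R).
split=> [s hs em|h s hs em].
  apply/seteqP; split=> a /=.
    by move/(belowE _ _ _ C)/(below_limit _ C lt hs em).
  by move/(below_limit _ C lt hs em)/(belowE _ _ _ C).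
have [hb hu] := below_ten_image C lt hs em; split=> //.
by apply/seteqP; split=> a /= => [/(belowE _ _ _ C)/hb|/hb/(belowE _ _ _ C)].
Qed.
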